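(* Let $S$ be a semilattice-ordered semigroup and let $\mathrm{cl}$ be an algebraic closure operator on $S$. Let $X=\{A\in\mathcal{P}(S)\mid A^{\mathrm{cl}}=A\}$ and $X_{\mathrm{fin}}=\{F^{\mathrm{cl}}\mid F\subseteq S\text{ finite}\}$. If the poset $(X_{\mathrm{fin}},\subseteq)$ is well-quasi-ordered, then the map $\star:X\times X\to X$, $A\star B=(AB)^{\mathrm{cl}}$, is spectral.
   Context: A semilattice-ordered semigroup is a triple $(S,\cdot,\lor)$ with $S$ nonempty, $(S,\cdot)$ a semigroup, $(S,\lor)$ a semilattice (commutative, associative, idempotent), and $x(y\lor z)=xy\lor xz$, $(x\lor y)z=xz\lor yz$ for all $x,y,z\in S$. For $A,B\subseteq S$, $AB=\{ab\mid a\in A,b\in B\}$. $\mathcal{P}(S)$ is the power set of $S$ and $\mathcal{P}_{\mathrm{fin}}(A)$ is the set of finite subsets of $A$. A closure operator on $S$ is a map $\mathrm{cl}:\mathcal{P}(S)\to\mathcal{P}(S)$, written $A\mapsto A^{\mathrm{cl}}$, which is extensive, idempotent and order-preserving for inclusion. It is algebraic if $A^{\mathrm{cl}}=\bigcup\{F^{\mathrm{cl}}\mid F\in\mathcal{P}_{\mathrm{fin}}(A)\}$ for every $A\subseteq S$. A preordered set $(P,\leqslant)$ is well-quasi-ordered if every infinite sequence $(x_n)_{n\in\mathbb{N}}$ in $P$ admits indices $m<n$ with $x_m\leqslant x_n$. The hull-kernel topology on $\mathcal{P}(S)$ has open subbasis $D(F)=\{A\in\mathcal{P}(S)\mid F\nsubseteq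 A\}$, $F\in\mathcal{P}_{\mathrm{fin}}(S)$. $X$ carries the subspace topology; since $\mathrm{cl}$ is algebraic, $X$ is a spectral space (quasi-compact, $T_0$, sober, with quasi-compact opens closed under finite intersections and forming a basis), and $X\times X$ with the product topology is a spectral space. A map between spectral spaces is spectral if the preimage of every quasi-compact open set is quasi-compact and open. *)

(* Defs.v *)
From HB Require Import structures.
From mathcomp Require Import all_boot all_order monoid.
From mathcomp Require Import all_classical topology.

Set Implicit Arguments.
Unset Strict Implicit.
Unset Printing Implicit Defensive.

Local Open Scope classical_set_scope.
Local Open Scope group_scope.

(* The semilattice operation is [Order.join]; the order carried by a
   [joinSemilatticeType] is the one it determines, [x <= y] iff [x `|` y = y]. *)
HB.mixin Record isSemilatticeOrderedSemigroup (d : Order.disp_t) S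
    & Semigroup S & Order.JoinSemilattice d S := {
  sosemigroup_nonempty : [set: S] !=set0 ;
  mulg_joinr : right_distributive (@mul S) (@Order.join d S) ;
  mulg_joinl : left_distributive (@mul S) (@Order.join d S)
}.

#[short(type="sosemigroupType")]
HB.structure Definition SemilatticeOrderedSemigroup (d : Order.disp_t) :=
  { S of Semigroup S & Order.JoinSemilattice d S
    & isSemilatticeOrderedSemigroup d S }.

Definition set_mul (S : semigroupType) (A B : set S) : set S :=
  [set a * b | a in A & b in B].

Record closure_operator (S : Type) := ClosureOperator {
  cl :> set S -> set S ;
  cl_extensive : forall A, A `<=` cl A ;
  cl_idempotent : forall A, cl (cl A) = cl A ;
  cl_monotone : forall A B, A `<=` B -> cl A `<=` cl B
}.

Definition algebraic (S : Type) (c : closure_operator S) : Prop :=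
  forall A, c A = \bigcup_(F in [set F | finite_set F /\ F `<=` A]) c F.

Definition well_quasi_ordered (T : Type) (le : T -> T -> Prop) (P : set T) :
    Prop :=
  forall x : nat -> T, (forall n, P (x n)) ->
    exists m n, (m < n)%N /\ le (x m) (x n).

(* An alias, so that the topology is not attached to every [set S]. *)
Definition hull_kernel (S : Type) : Type := set S.

HB.instance Definition _ (S : Type) := Choice.on (hull_kernel S).
HB.instance Definition _ (S : Type) :=
  isSubBaseTopological.Build (hull_kernel S)
    (@finite_set S) (fun F : set S => [set A : hull_kernel S | ~ F `<=` A]).

(* Coerced to a type (by [set_type]), this carries the subspace topology. *)
Definition closed_sets (S : Type) (c : closure_operator S) :
    set (hull_kernel S) :=
  [set A | c A = A].

Definition fin_closed_sets (S : Type) (c : closure_operator S) : set (set S) :=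
  [set c F | F in @finite_set S].

Definition star (S : semigroupType) (c : closure_operator S)
    (p : closed_sets c * closed_sets c) : closed_sets c :=
  exist _ (c (set_mul (set_val p.1) (set_val p.2)) : hull_kernel S)
    (mem_set (cl_idempotent c _)).

(* [compact] is the library's filter-based quasi-compactness (no separation
   assumed), equal to the open-cover definition by [compact_cover]. *)
Definition spectral_map (X Y : topologicalType) (f : X -> Y) : Prop :=
  forall U : set Y, compact U -> open U ->
    compact (f @^-1` U) /\ open (f @^-1` U).

(* Main.v *)
Require Import Defs.
From mathcomp Require Import all_boot all_order monoid.
From mathcomp Require Import all_classical topology.

Set Implicit Arguments.
Unset Strict Implicit.
Unset Printing Implicit Defensive.

Local Open Scope classical_set_scope.

(** Preimages of quasi-compact open sets are open because the map is continuous,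
    and quasi-compact by an ultrafilter argument.

    Continuity ([star_continuous]) is where the well-quasi-order enters. The
    topology of X is generated by the conditions x \notin A, so the
    pairs (A, B) with x in cl (AB) must form a closed set. Since cl is
    algebraic, x lies in cl (AB) iff x lies in cl (CD) for some finitely
    generated closed C and D contained in A and B. Each condition C <= A is
    closed, but there may be infinitely many pairs (C, D). The pairs of
    finitely generated closed sets form a product of two well-quasi-orders,
    hence a well-quasi-order ([wqo_prod]), so finitely many of these pairs lie
    below all the others ([wqo_finite_basis]) and a finite union suffices
    ([closed_star_mem]).

    Quasi-compactness ([star_compact_preimage]) rests on cl being algebraic.
    Along an ultrafilter F, a family of closed sets has a limit in the patch
    (constructible) topology: the set of points that belong to F-almost all
    members. This limit is closed under cl because cl is algebraic, and the
    family converges to it in the hull-kernel topology. So an ultrafilter on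
    X x X that contains the preimage of a quasi-compact open U converges to the
    pair (A, B) of its coordinatewise patch limits. The image filter clusters
    at some u in U, and algebraicity gives star (A, B) <= u. Open sets of X
    are closed downwards for inclusion, so star (A, B) is in U. *)

(** * Well-quasi-orders *)

(** Call an index a peak if no later term lies above its term. Peaks cannot
    occur arbitrarily far out, for a sequence of peaks would violate the
    well-quasi-order; beyond the last one, climbing never stops. *)
Lemma wqo_nondecreasing_subsequence (T : Type) (le : T -> T -> Prop)
    (P : set T) (x : nat -> T) :
    (forall b a d, le a b -> le b d -> le a d) ->
    well_quasi_ordered le P -> (forall n, P (x n)) ->
  exists2 phi : nat -> nat, {homo phi : m n / (m < n)%N} &
    {homo x \o phi : m n / (m < n)%N >-> le m n}.
Proof.
move=> le_trans wqoP Px.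
have [N climb] : exists N, forall n, (N <= n)%N ->
    exists m, (n < m)%N /\ le (x n) (x m).
  apply: contrapT => /forallNP noN.
  have /choice[peak peakP] : forall N, exists n, (N <= n)%N /\
      forall m, (n < m)%N -> ~ le (x n) (x m).
    move=> N; have /existsNP[n /not_implyP[Nn /forallNP nm]] := noN N.
    by exists n; split=> // m ltnm lexx; apply: (nm m).
  pose y := fix y k := if k is k'.+1 then peak (y k').+1 else peak 0%N.
  have y_incr : {homo y : m n / (m < n)%N}.
    apply: homo_ltn => [? ? ?|k]; first exact: ltn_trans.
    by have [] := peakP (y k).+1.
  have [m [n [mn lexx]]] := wqoP (x \o y) (fun n => Px (y n)).
  have [k ym] : exists k, y m = peak k by case: (m) => [|m']; eexists.
  have [_] := peakP k; rewrite -ym => /(_ (y n) (y_incr _ _ mn)); exact.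
have /choice[next nextP] : forall n, exists m, (N <= n)%N ->
    (n < m)%N /\ le (x n) (x m).
  move=> n; have [/climb[m mP]|ltnN] := leqP N n; first by exists m.
  by exists 0%N.
pose phi k := iter k next N.
have N_phi k : (N <= phi k)%N.
  by elim: k => //= k IH; apply: leq_trans IH (ltnW (nextP _ IH).1).
exists phi; apply: homo_ltn => //.
- by move=> ? ? ?; exact: ltn_trans.
- by move=> k; exact: (nextP _ (N_phi k)).1.
- by move=> k; exact: (nextP _ (N_phi k)).2.
Qed.

(** Along a subsequence that is nondecreasing in the first coordinate, it is
    enough to find a good pair for the second. *)
Lemma wqo_prod (T1 T2 : Type) (le1 : T1 -> T1 -> Prop) (le2 : T2 -> T2 -> Prop)
    (P1 : set T1) (P2 : set T2) :
    (forall b a d, le1 a b -> le1 b d -> le1 a d) ->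
    well_quasi_ordered le1 P1 -> well_quasi_ordered le2 P2 ->
  well_quasi_ordered (fun p q => le1 p.1 q.1 /\ le2 p.2 q.2) (P1 `*` P2).
Proof.
move=> le1_trans wqo1 wqo2 x Px.
have [phi phi_incr le_phi] := wqo_nondecreasing_subsequence (x := fst \o x)
  le1_trans wqo1 (fun n => (Px n).1).
have [m [n [mn le_mn]]] := wqo2 (snd \o x \o phi) (fun n => (Px (phi n)).2).
by exists (phi m), (phi n); split; [exact: phi_incr|split=> //; exact: le_phi].
Qed.

(** If no finite part of Q is a basis, elements of Q can be picked one after
    the other, each above none of the previous ones; such a sequence is bad. *)
Lemma wqo_finite_basis (T : Type) (le : T -> T -> Prop) (P Q : set T) :
    well_quasi_ordered le P -> Q `<=` P ->
  exists B, [/\ finite_set B, B `<=` Q &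
    forall q, Q q -> exists2 b, B b & le b q].
Proof.
move=> wqoP QP; apply: contrapT => /forallNP noB.
have missed B : finite_set B -> B `<=` Q ->
    exists q, Q q /\ forall b, B b -> ~ le b q.
  move=> finB BQ; apply: contrapT => /forallNP allq; apply: (noB B); split=> //.
  move=> q Qq; apply: contrapT => noq; apply: (allq q); split=> // b Bb lebq.
  by apply: noq; exists b.
(* Only a default value, to make the choice function [next] total. *)
have [q0 _] := missed set0 (finite_set0 _) (@sub0set _ _).
have /choice[next nextP] : forall B, exists q, finite_set B -> B `<=` Q ->
    Q q /\ forall b, B b -> ~ le b q.
  move=> B; have [[finB BQ]|nB] := pselect (finite_set B /\ B `<=` Q).
    by have [q qP] := missed B finB BQ; exists q.
  by exists q0 => finB BQ; case: nB.
pose B n := iter n (fun B => next B |` B) set0.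
have BP n : finite_set (B n) /\ B n `<=` Q.
  elim: n => [|n [finB BQ]]; first by split=> //; exact: finite_set0.
  split; first by rewrite /= finite_setU; split=> //; exact: finite_set1.
  by move=> q [->|/BQ//]; exact: (nextP _ finB BQ).1.
have newP n : Q (next (B n)) /\ forall b, B n b -> ~ le b (next (B n)).
  by have [] := BP n; exact: nextP.
have [m [n [mn le_mn]]] := wqoP (next \o B) (fun n => QP _ (newP n).1).
apply: (newP n).2 le_mn => /=.
elim: n mn => // n IH; rewrite ltnS leq_eqVlt => /orP[/eqP->|/IH].
  by left.
by right.
Qed.

(** * The space of closed sets *)

Section HullKernel.
Context {S : Type} (c : closure_operator S).

Lemma open_not_containing (F : set S) : finite_set F ->
  open [set A : closed_sets c | ~ F `<=` set_val A].
Proof.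
move=> finF; exists [set A : hull_kernel S | ~ F `<=` A] => //.
exists [set [set A : hull_kernel S | ~ F `<=` A]].
  move=> _ ->.
  exact: (finI_from1 (fun G : set S => [set A : hull_kernel S | ~ G `<=` A])
            finF).
by rewrite bigcup_set1.
Qed.

(** A subbasic open set is the union over x in F of the sets of those A that
    miss x, so the singletons F already generate the topology. *)
Lemma cvg_closed_sets (T : Type) (F : set_system T) (FF : Filter F)
    (f : T -> closed_sets c) (A : closed_sets c) :
    (forall x, ~ set_val A x -> \forall t \near F, ~ set_val (f t) x) ->
  f @ F --> A.
Proof.
move=> cvgA V [/= _ [[W [D' D'sub DW] <-] WA] WV].
rewrite -DW in WA WV.
case: WA => /= G D'G GA.
have [E Esub EG] := D'sub _ D'G.
suff : F (f @^-1` (set_val @^-1` G)).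
  by apply: filterS => t fG; apply: WV; exists G.
rewrite -EG.
apply: (@filter_bigI _ _ E (fun H => [set t | ~ H `<=` set_val (f t)])) => H HE.
have : ~ H `<=` set_val A by move: GA; rewrite -EG; apply.
move=> /existsNP[x /not_implyP[Hx Ax]].
by apply: filterS (cvgA x Ax) => t fx /(_ _ Hx).
Qed.

Lemma cl_subset_closed (F : set S) (A : closed_sets c) :
  F `<=` set_val A -> c F `<=` set_val A.
Proof.
move=> FA; have cA : c (set_val A) = set_val A := set_valP A.
by rewrite -cA; exact: cl_monotone.
Qed.

(** A closed set contains cl F iff it contains F, so the complement is
    subbasic. *)
Lemma closed_containing (C : set S) : fin_closed_sets c C ->
  closed [set A : closed_sets c | C `<=` set_val A].
Proof.
move=> [F finF <-].
rewrite -[X in closed X]setCK closedC.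
have -> : ~` [set A : closed_sets c | c F `<=` set_val A] =
    [set A : closed_sets c | ~ F `<=` set_val A].
  congr (~` _); apply/seteqP; split=> A /=; last exact: cl_subset_closed.
  exact: subset_trans (@cl_extensive _ c F).
exact: open_not_containing.
Qed.

(** Inclusion is the specialization order: a family constantly equal to A
    converges to every closed set that contains A. *)
Lemma open_closed_sets_subset (U : set (closed_sets c)) (A B : closed_sets c) :
  open U -> U B -> set_val A `<=` set_val B -> U A.
Proof.
move=> openU UB AB.
have cvgB : (fun=> A) @ (nbhs A) --> B.
  by apply: cvg_closed_sets => x Bx; apply: nearW => _ /AB.
have UA : \forall t \near nbhs A, U A.
  exact: (cvgB U (open_nbhs_nbhs (conj openU UB))).
by have [] := filter_ex UA.
Qed.

(** When F is an ultrafilter, this is the limit of f along F in the patch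
    topology, that is, for the product topology on the powerset of S. *)
Definition patch_limit (T : Type) (F : set_system T)
  (f : T -> closed_sets c) : set S :=
  [set x | \forall t \near F, set_val (f t) x].

Lemma patch_limit_finite_subset (T : Type) (F : set_system T) (FF : Filter F)
    (f : T -> closed_sets c) (G : set S) : finite_set G ->
  G `<=` patch_limit F f -> \forall t \near F, G `<=` set_val (f t).
Proof.
move=> finG GA.
have /(@finite_fsetP {classic S})[E GE] := finG.
have FE := @filter_bigI _ {classic S} E (fun x => [set t | set_val (f t) x]).
apply: filterS (FE F FF _) => [t Et x Gx|x xE]; first by apply: Et; rewrite -GE.
by apply: GA; rewrite GE.
Qed.

(** A point of the closure of the limit depends on finitely many points of the
    limit, and these belong simultaneously to F-almost all f t. *)
Lemma patch_limit_closed (T : Type) (F : set_system T) (FF : Filter F)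
    (f : T -> closed_sets c) : algebraic c ->
  closed_sets c (patch_limit F f).
Proof.
move=> c_alg; apply/seteqP; split; last exact: cl_extensive.
rewrite c_alg => x [G [finG GA] cGx].
apply: filterS (patch_limit_finite_subset FF finG GA) => t Gt.
exact: cl_subset_closed cGx.
Qed.

Definition patch_limit_point (T : Type) (F : set_system T) {FF : Filter F}
    (f : T -> closed_sets c) (c_alg : algebraic c) : closed_sets c :=
  exist _ (patch_limit F f : hull_kernel S)
    (mem_set (patch_limit_closed FF f c_alg)).

(** The hull-kernel topology is coarser than the patch topology. The
    ultrafilter property turns a point that is not in almost all f t into a
    point missed by almost all f t. *)
Lemma ultra_cvg_patch_limit (T : Type) (F : set_system T) (FF : Filter F)
    (f : T -> closed_sets c) (c_alg : algebraic c) : UltraFilter F ->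
  f @ F --> patch_limit_point (FF := FF) f c_alg.
Proof.
move=> FU; apply: cvg_closed_sets => x.
by have [] := in_ultra_setVsetC [set t | set_val (f t) x] FU.
Qed.
End HullKernel.

(** * The product of closed sets *)

Section Star.
Context {S : semigroupType} (c : closure_operator S).
Local Open Scope group_scope.

Lemma set_mul_subset (A A' B B' : set S) :
  A `<=` A' -> B `<=` B' -> set_mul A B `<=` set_mul A' B'.
Proof.
move=> AA' BB' _ [a /AA' A'a [b /BB' B'b <-]].
by exists a => //; exists b.
Qed.

Lemma cl_set_mul_fin (A B : set S) (x : S) : algebraic c ->
    c (set_mul A B) x ->
  exists F G, [/\ finite_set F, F `<=` A, finite_set G, G `<=` B &
    c (set_mul F G) x].
Proof.
move=> c_alg; rewrite c_alg => -[H [finH HAB] cHx].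
have /choice[ab abP] : forall h, exists ab : S * S, H h ->
    [/\ A ab.1, B ab.2 & ab.1 * ab.2 = h].
  move=> h; have [/HAB[a Aa [b Bb <-]]|nHh] := pselect (H h).
    by exists (a, b).
  by exists (h, h).
exists ((fst \o ab) @` H), ((snd \o ab) @` H); split.
- exact: finite_image.
- by move=> _ [h /abP[Aa _ _] <-].
- exact: finite_image.
- by move=> _ [h /abP[_ Bb _] <-].
apply: cl_monotone cHx => h Hh; have [_ _ abh] := abP h Hh.
by exists (ab h).1; [exists h|exists (ab h).2 => //; exists h].
Qed.

(** The set is the union, over pairs (C, D) of finitely generated closed sets
    with x in cl (CD), of the closed conditions C <= A and D <= B. Replacing
    (C, D) by a smaller pair weakens the condition, so a finite basis of these
    pairs gives the same union. *)
Lemma closed_star_mem (x : S) : algebraic c ->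
    well_quasi_ordered (@subset S) (fin_closed_sets c) ->
  closed [set p : closed_sets c * closed_sets c | set_val (star p) x].
Proof.
move=> c_alg Xfin_wqo.
pose Q := [set CD : set S * set S | [/\ fin_closed_sets c CD.1,
  fin_closed_sets c CD.2 & c (set_mul CD.1 CD.2) x]].
have [|M [finM MQ Mbasis]] := wqo_finite_basis (Q := Q)
    (wqo_prod (@subset_trans S) Xfin_wqo Xfin_wqo).
  by move=> [C D] [].
have -> : [set p : closed_sets c * closed_sets c | set_val (star p) x] =
  \bigcup_(CD in M) ((fst @^-1` [set A : closed_sets c | CD.1 `<=` set_val A])
    `&` (snd @^-1` [set B : closed_sets c | CD.2 `<=` set_val B])).
  apply/seteqP; split=> [[A B] /= ABx|[A B] [CD /MQ[_ _ CDx] [/= CA DB]]];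
    last first.
    by apply: cl_monotone CDx; exact: set_mul_subset.
  have [F [G [finF FA finG GB FGx]]] := cl_set_mul_fin c_alg ABx.
  have [|CD MCD [CF DG]] := Mbasis (c F, c G).
    split; [by exists F|by exists G|].
    by apply: cl_monotone FGx; apply: set_mul_subset; exact: cl_extensive.
  exists CD => //; split=> /=.
    exact: subset_trans CF (cl_subset_closed FA).
  exact: subset_trans DG (cl_subset_closed GB).
apply: closed_bigcup => // CD /MQ[finC finD _]; apply: closedI.
  by apply: closed_comp => [? _|]; [exact: cvg_fst|exact: closed_containing].
by apply: closed_comp => [? _|]; [exact: cvg_snd|exact: closed_containing].
Qed.

Lemma star_continuous : algebraic c ->
    well_quasi_ordered (@subset S) (fin_closed_sets c) ->
  continuous (@star S c).
Proof.
move=> c_alg Xfin_wqo p; apply: cvg_closed_sets => x px.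
have : open_nbhs p (~` [set q | set_val (star q) x]).
  by split=> //; apply: closed_openC; exact: closed_star_mem.
exact: open_nbhs_nbhs.
Qed.

(** The point of U at which the image filter clusters need not be the product
    of the patch limits, but it contains that product, which is enough because
    U is closed downwards. *)
Lemma star_compact_preimage (U : set (closed_sets c)) : algebraic c ->
  compact U -> open U -> compact (@star S c @^-1` U).
Proof.
move=> c_alg compU openU; rewrite compact_ultra => F FU FstarU.
have FF : Filter F by exact: _.
pose A := patch_limit_point (FF := FF) fst c_alg.
pose B := patch_limit_point (FF := FF) snd c_alg.
exists (A, B); split; last first.
  have cvgA : fst @ F --> A by exact: ultra_cvg_patch_limit.
  have cvgB : snd @ F --> B by exact: ultra_cvg_patch_limit.
  move=> V [[P Q] [/= AP BQ] PQV]; suff : F V by [].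
  have FP : F (fst @^-1` P) := cvgA P AP.
  have FQ : F (snd @^-1` Q) := cvgB Q BQ.
  by apply: filterS2 FP FQ => p Pp Qp; exact: PQV.
(* Suppose x is in star (A, B) but not in u: then almost all products contain
   x, while the closed sets that miss x form a neighborhood of u. *)
have [u [Uu clu]] := compU (@star S c @ F) _ FstarU.
apply: (open_closed_sets_subset _ Uu) => // x ABx; apply: contrapT => ux.
have [F1 [G1 [finF FA finG GB FGx]]] := cl_set_mul_fin c_alg ABx.
have starx : (@star S c @ F) [set C | set_val C x].
  have subA := patch_limit_finite_subset FF finF FA.
  have subB := patch_limit_finite_subset FF finG GB.
  apply: filterS2 subA subB => p FpA GpB.
  exact: cl_monotone (set_mul_subset FpA GpB) _ FGx.
have nbhsu : nbhs u [set C : closed_sets c | ~ [set x] `<=` set_val C].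
  apply: open_nbhs_nbhs; split; last by move=> /(_ x erefl).
  exact/open_not_containing/finite_set1.
have [C [Cx]] := clu _ _ starx nbhsu.
by apply=> _ ->.
Qed.
End Star.

Theorem proposition4p11 (d : Order.disp_t) (S : sosemigroupType d)
    (c : closure_operator S) (c_alg : algebraic c)
    (Xfin_wqo : well_quasi_ordered (@subset S) (fin_closed_sets c)) :
  spectral_map (@star S c).
Proof.
move=> U compU openU; split; first exact: star_compact_preimage.
by move/continuousP: (star_continuous c_alg Xfin_wqo); exact.
Qed.
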